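(* Let $d \ge 1$. A $\mathbb{Z}^d$-shift $X$ is an isolated point of $\mathcal{S}^d$ if and only if $X$ is of finite type, $X$ has finitely many maximal subsystems, and $X$ contains no outcast.
   Context: For a finite set $\mathcal{A}\subset\mathbb{Z}$, elements of $\mathcal{A}^{\mathbb{Z}^d}$ are called configurations. For configurations $x,y$ (possibly over different alphabets) set $\delta(x,y)=2^{-\inf\{\|\mathbf{n}\|_\infty : \mathbf{n}\in\mathbb{Z}^d,\ x_{\mathbf{n}}\neq y_{\mathbf{n}}\}}$ (and $\delta(x,x)=0$). The shift action is $\sigma^{\mathbf{u}}(x)_{\mathbf{v}}=x_{\mathbf{u}+\mathbf{v}}$. A $d$-dimensional shift (or $\mathbb{Z}^d$-shift) is a nonempty compact set $X\subset\mathcal{A}^{\mathbb{Z}^d}$, for some finite $\mathcal{A}\subset\mathbb{Z}$, with $\sigma^{\mathbf{u}}(X)\subset X$ for all $\mathbf{u}\in\mathbb{Z}^d$. $\mathcal{S}^d$ is the set of all $d$-dimensional shifts (over all finite alphabets $\mathcal{A}\subset\mathbb{Z}$), with the Hausdorff metric $\delta_H(X,Z)=\max\left(\sup_{x\in X}\inf_{z\in Z}\delta(x,z),\ \sup_{z\in Z}\inf_{x\in X}\delta(z,x)\right)$. A finite pattern is a map $p:\mathbb{U}\to\mathcal{A}$ with $\mathbb{U}\subset\mathbb{Z}^d$ finite; it appears in $x$ if there is $\mathbf{u}$ with $x_{\mathbf{u}+\mathbf{v}}=p(\mathbf{v})$ for all $\mathbf{v}\in\mathbb{U}$. A shift $X$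 is of finite type if there are a finite alphabet $\mathcal{A}$ and a finite set $\mathcal{F}$ of finite patterns on $\mathcal{A}$ such that $X$ is the set of configurations of $\mathcal{A}^{\mathbb{Z}^d}$ in which no pattern of $\mathcal{F}$ appears. A subsystem of $X$ is a nonempty closed shift-invariant subset of $X$; it is proper (strict) if it differs from $X$. A subsystem of $X$ is maximal if it is proper and is not contained in any other proper subsystem of $X$. A subsystem of $X$ is an outcast if it is proper and is not contained in any maximal subsystem of $X$. *)

(* Defs.v *)
From HB Require Import structures.
From mathcomp Require Import all_boot all_order all_algebra finmap.
From mathcomp Require Import all_classical all_reals all_analysis.

Set Implicit Arguments.
Unset Strict Implicit.
Unset Printing Implicit Defensive.

Import Order.TTheory GRing.Theory Num.Theory.
Import numFieldNormedType.Exports.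

Local Open Scope classical_set_scope.
Local Open Scope ring_scope.

(* Configurations over all finite alphabets live in the common type of maps
   Z^d -> Z; alphabets are imposed on sets of configurations.  The parameter R
   only records the field in which the metric takes its values, so that the
   topology can be inferred from the type. *)
Definition config (R : realType) (d : nat) : Type := 'rV[int]_d -> int.

HB.instance Definition _ (R : realType) (d : nat) := gen_eqMixin (config R d).
HB.instance Definition _ (R : realType) (d : nat) :=
  gen_choiceMixin (config R d).

(* [`|n|] is the sup norm of the row vector n.  The case x = y is separated
   because the real infimum of the empty set is 0 and not +oo. *)
Definition delta (R : realType) (d : nat) (x y : config R d) : R :=
  if `[< x = y >] then 0
  else 2 `^ (- inf [set (`|n|)%:~R | n in [set n : 'rV[int]_d | x n != y n]]).

Section delta_metric.
Context {R : realType} {d : nat}.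
Implicit Types x y z : config R d.

Let D x y : set R := [set (`|n|)%:~R | n in [set n : 'rV[int]_d | x n != y n]].

Let D_inf x y : x <> y -> has_inf (D x y).
Proof.
move=> xy; split; last by exists 0 => _ [n _ <-]; rewrite ler0z.
have [n xyn] : exists n, x n <> y n.
  apply: contrapT => /forallNP xyE; apply: xy; apply/funext => n.
  by apply: contrapT => nxy; exact: (xyE n).
by exists (`|n|)%:~R; exists n => //; apply/eqP.
Qed.

Let deltaE x y : x <> y -> delta x y = 2 `^ (- inf (D x y)).
Proof. by move=> xy; rewrite /delta asboolF. Qed.

Lemma deltaxx x : delta x x = 0.
Proof. by rewrite /delta asboolT. Qed.

Lemma delta_ge0 x y : 0 <= delta x y.
Proof. by rewrite /delta; case: ifP => // _; exact: powR_ge0. Qed.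

Lemma delta_le1 x y : delta x y <= 1.
Proof.
have [->|xy] := pselect (x = y); first by rewrite deltaxx.
rewrite deltaE// -[leRHS](powRr0 2) ler_powR ?ler1n// oppr_le0.
by apply: lb_le_inf; [exact: (D_inf xy).1|move=> _ [n _ <-]; rewrite ler0z].
Qed.

Lemma delta_positivity x y : delta x y = 0 -> x = y.
Proof.
have [//|xy] := pselect (x = y); rewrite deltaE// => /eqP.
by rewrite gt_eqF// powR_gt0.
Qed.

Lemma delta_sym x y : delta x y = delta y x.
Proof.
have [->//|xy] := pselect (x = y).
rewrite !deltaE//; last exact/nesym.
by congr (_ `^ - inf _); apply/seteqP; split=> _ [n /= nxy <-];
  exists n => //=; rewrite eq_sym.
Qed.

Lemma delta_triangle y x z : delta x z <= delta x y + delta y z.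
Proof.
have [->|xz] := pselect (x = z); first by rewrite deltaxx addr_ge0// delta_ge0.
have [->|xy] := pselect (x = y); first by rewrite deltaxx add0r.
have [->|yz] := pselect (y = z); first by rewrite deltaxx addr0.
have [xyz|xyz] := leP (inf (D x y)) (inf (D x z)).
  rewrite (@le_trans _ _ (delta x y))// ?lerDl ?delta_ge0//.
  by rewrite !deltaE// ler_powR ?ler1n// lerN2.
rewrite (@le_trans _ _ (delta y z))// ?lerDr ?delta_ge0//.
rewrite !deltaE// ler_powR ?ler1n// lerN2 leNgt; apply/negP => yxz.
have [e [e0 [exy eyz]]] : exists e, 0 < e /\
    inf (D x z) + e <= inf (D x y) /\ inf (D x z) + e <= inf (D y z).
  exists (Num.min (inf (D x y)) (inf (D y z)) - inf (D x z)).
  by rewrite subr_gt0 lt_min xyz yxz; split => //; rewrite addrC subrK;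
    rewrite !ge_min !lexx ?orbT.
have [_ [n /= nxz <-] nlt] := inf_adherent e0 (D_inf xz).
have nD u v : u <> v -> inf (D x z) + e <= inf (D u v) -> u n = v n.
  move=> uv le_uv; apply/eqP; apply: contraT => nuv.
  have := lt_le_trans nlt le_uv; rewrite ltNge ge_inf//; last by exists n.
  exact: (D_inf uv).2.
by move: nxz; rewrite (nD _ _ xy exy) (nD _ _ yz eyz) eqxx.
Qed.

HB.instance Definition _ := @isMetric.Build R (config R d) (@delta R d)
  deltaxx delta_positivity delta_sym delta_triangle.

End delta_metric.

Definition sigma (R : realType) (d : nat) (u : 'rV[int]_d) (x : config R d) :
  config R d := fun v => x (u + v).

Definition full_shift (R : realType) (d : nat) (A : {fset int}) :
  set (config R d) := [set x | forall v, x v \in A].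

Definition shift_invariant (R : realType) (d : nat) (X : set (config R d)) :=
  forall u : 'rV[int]_d, sigma u @` X `<=` X.

Definition is_shift (R : realType) (d : nat) (X : set (config R d)) : Prop :=
  [/\ exists A : {fset int}, X `<=` full_shift A,
      X !=set0,
      compact X
    & shift_invariant X].

Record shift_space (R : realType) (d : nat) : Type := ShiftSpace {
  shift_set :> set (config R d);
  shift_is_shift : is_shift shift_set
}.

HB.instance Definition _ (R : realType) (d : nat) := gen_eqMixin (shift_space R d).
HB.instance Definition _ (R : realType) (d : nat) :=
  gen_choiceMixin (shift_space R d).

Definition delta_H (R : realType) (d : nat) (X Z : shift_space R d) : R :=
  Num.max (sup [set inf [set delta x z | z in Z] | x in X])
          (sup [set inf [set delta z x | x in X] | z in Z]).

Section hausdorff_metric.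
Context {R : realType} {d : nat}.
Implicit Types (x y z : config R d) (X Y Z : shift_space R d).

Let pdist x Z := inf [set delta x z | z in Z].
Let excess X Z := sup [set pdist x Z | x in X].

Let pdist_le x Z z : (Z : set _) z -> pdist x Z <= delta x z.
Proof.
move=> Zz; apply: ge_inf; last by exists z.
by exists 0 => _ [? _ <-]; exact: delta_ge0.
Qed.

Let le_pdist x Z r :
  (forall z, (Z : set _) z -> r <= delta x z) -> r <= pdist x Z.
Proof.
move=> rZ; have [_ [z Zz] _ _] := shift_is_shift Z.
apply: lb_le_inf; first by exists (delta x z); exists z.
by move=> _ [t Zt <-]; exact: rZ.
Qed.

Let pdist_le_excess X Z x : (X : set _) x -> pdist x Z <= excess X Z.
Proof.
move=> Xx; have [_ [z Zz] _ _] := shift_is_shift Z.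
apply: ub_le_sup; last by exists x.
by exists 1 => _ [t _ <-]; rewrite (le_trans (pdist_le _ Zz))// delta_le1.
Qed.

Let excess_le X Z r :
  (forall x, (X : set _) x -> pdist x Z <= r) -> excess X Z <= r.
Proof.
move=> Xr; have [_ [x Xx] _ _] := shift_is_shift X.
apply: ge_sup; first by exists (pdist x Z); exists x.
by move=> _ [t Xt <-]; exact: Xr.
Qed.

Let pdist_ge0 x Z : 0 <= pdist x Z.
Proof. by apply: le_pdist => z _; exact: delta_ge0. Qed.

Let excess_triangle Y X Z : excess X Z <= excess X Y + excess Y Z.
Proof.
apply: excess_le => x Xx.
rewrite (@le_trans _ _ (pdist x Y + excess Y Z))//; last first.
  by rewrite lerD2r pdist_le_excess.
rewrite -lerBlDr; apply: le_pdist => y Yy; rewrite lerBlDr.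
rewrite (@le_trans _ _ (delta x y + pdist y Z))//; last first.
  by rewrite lerD2l pdist_le_excess.
rewrite -lerBlDl; apply: le_pdist => z Zz; rewrite lerBlDl.
by rewrite (le_trans (pdist_le x Zz))// delta_triangle.
Qed.

Let excess_subset X Z : excess X Z <= 0 -> X `<=` Z.
Proof.
move=> XZ0 x Xx.
have [_ _ cZ _] := shift_is_shift Z.
have clZ := compact_closed (@metric_hausdorff R (config R d)) cZ.
apply: clZ => U /nbhs_ballP[e /= e0 xeU].
have : inf [set delta x z | z in Z] < e.
  by rewrite (le_lt_trans (pdist_le_excess Z Xx))// (le_lt_trans XZ0).
apply: contraPP => /set0P/negP/negPn/eqP ZU0.
apply/negP; rewrite -leNgt; apply: le_pdist => z Zz; rewrite leNgt.
apply/negP => xze; suff : (Z `&` U) z by rewrite ZU0.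
by split => //; apply: xeU; rewrite ballEmdist.
Qed.

Let delta_HE X Z : delta_H X Z = Num.max (excess X Z) (excess Z X).
Proof. by []. Qed.

Lemma delta_Hxx X : delta_H X X = 0.
Proof.
have [_ [x Xx] _ _] := shift_is_shift X.
rewrite delta_HE maxxx; apply/eqP; rewrite eq_le; apply/andP; split.
  by apply: excess_le => z Xz; rewrite -(deltaxx z) pdist_le.
exact: le_trans (pdist_ge0 x X) (pdist_le_excess X Xx).
Qed.

Lemma delta_H_positivity X Z : delta_H X Z = 0 -> X = Z.
Proof.
rewrite delta_HE => /eqP; rewrite eq_le ge_max => /andP[/andP[XZ ZX] _].
have : X = Z :> set _ by apply/seteqP; split; exact: excess_subset.
case: X Z {XZ ZX} => [X pX] [Z pZ] /= XZ; rewrite -XZ in pZ *.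
by congr ShiftSpace; exact: Prop_irrelevance.
Qed.

Lemma delta_H_sym X Z : delta_H X Z = delta_H Z X.
Proof. by rewrite !delta_HE maxC. Qed.

Lemma delta_H_triangle Y X Z : delta_H X Z <= delta_H X Y + delta_H Y Z.
Proof.
rewrite !delta_HE ge_max; apply/andP; split.
  by rewrite (le_trans (excess_triangle Y _ _))// lerD// le_max lexx.
rewrite (le_trans (excess_triangle Y _ _))// addrC.
by rewrite lerD// le_max lexx orbT.
Qed.

HB.instance Definition _ := @isMetric.Build R (shift_space R d) (@delta_H R d)
  delta_Hxx delta_H_positivity delta_H_sym delta_H_triangle.

End hausdorff_metric.

(* A map p : U -> Z with U a finite subset of Z^d: [domf p] is U. *)
Definition pattern (d : nat) := {fmap 'rV[int]_d -> int}.

Definition pattern_on (d : nat) (A : {fset int}) (p : pattern d) : Prop :=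
  forall v : domf p, p v \in A.

Definition appears (R : realType) (d : nat) (p : pattern d) (x : config R d) :
  Prop := exists u : 'rV[int]_d, forall v : domf p, x (u + val v) = p v.

Definition finite_type (R : realType) (d : nat) (X : set (config R d)) :
  Prop :=
  exists (A : {fset int}) (F : {fset pattern d}),
    (forall p, p \in F -> pattern_on A p) /\
    X = [set x | full_shift A x /\ forall p, p \in F -> ~ appears p x].

Definition subsystem (R : realType) (d : nat) (X Y : set (config R d)) :
  Prop :=
  [/\ Y `<=` X, Y !=set0, closed Y & shift_invariant Y].

Definition proper_subsystem (R : realType) (d : nat)
  (X Y : set (config R d)) : Prop := subsystem X Y /\ Y <> X.

Definition maximal_subsystem (R : realType) (d : nat)
  (X Y : set (config R d)) : Prop :=
  proper_subsystem X Y /\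
  forall Z, proper_subsystem X Z -> Y `<=` Z -> Z = Y.

Definition outcast (R : realType) (d : nat) (X Y : set (config R d)) : Prop :=
  proper_subsystem X Y /\ ~ exists2 Z, maximal_subsystem X Z & Y `<=` Z.

(* Main.v *)
(* The n-language of X is the set of restrictions of its points to the ball of
   radius n.  Two shifts are close in the Hausdorff metric exactly when they
   have the same n-language for a large n, so X is isolated iff for some n it
   is the only shift with its n-language.

   If so, X is the subshift of finite type defined by its n-language.  Only
   finitely many n-languages occur in X, and a proper subsystem Y is contained
   in the set of points of X whose n-windows all belong to the n-language of Y,
   which is proper as well because its n-language is that of Y.  Maximal
   subsystems are thus determined by their n-languages, and every proper
   subsystem is contained in a maximal one.

   Conversely, for n large, a shift Z with the n-language of X satisfies the
   finitely many constraints defining X, hence is a subsystem of X; and the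
   n-language of each of the finitely many maximal subsystems differs from that
   of X, so Z is contained in none of them and equals X. *)

Require Import Defs.
From HB Require Import structures.
From mathcomp Require Import all_boot all_order all_algebra finmap.
From mathcomp Require Import all_classical all_reals all_analysis.

Set Implicit Arguments.
Unset Strict Implicit.
Unset Printing Implicit Defensive.

From mathcomp Require Import zify.
Import Order.TTheory GRing.Theory Num.Theory.
Import numFieldNormedType.Exports.

Local Open Scope classical_set_scope.
Local Open Scope ring_scope.

Section Patterns.
Context {R : realType} {d : nat}.
Implicit Types (x y z : config R d) (X Y Z : set (config R d)) (n : nat)
  (u v : 'rV[int]_d) (A : {fset int}) (S : set (pattern d)).

(** * Windows on balls and the topology they generate *)

Lemma finite_ball_int n : finite_set [set v : 'rV[int]_d | `|v| <= n%:Z].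
Proof.
(* Coordinates in [[-n, n]] are coded by [0..2n] through translation by [n]. *)
pose g (f : {ffun 'I_d -> 'I_(n.*2.+1)}) : 'rV[int]_d :=
  \row_j ((f j)%:Z - n%:Z).
apply: (@sub_finite_set _ _ (range g)); last first.
  exact: finite_image (@finite_finset _ _).
move=> v /= vn; exists [ffun j => inord (absz (v ord0 j + n%:Z))] => //.
apply/rowP => j; rewrite mxE ffunE.
have : `|v ord0 j| <= n%:Z.
  apply: le_trans vn; rewrite /Num.norm /= mx_normrE.
  by apply/bigmax_geP; right; exists (ord0, j).
move=> vj; rewrite inordK; last by lia.
rewrite (ord1 ord0) in vj *; lia.
Qed.

Definition box n : {fset 'rV[int]_d} :=
  fset_set [set v : 'rV[int]_d | `|v| <= n%:Z].

Lemma in_box n v : (v \in box n) = (`|v| <= n%:Z).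
Proof.
rewrite in_fset_set; last exact: finite_ball_int.
by apply/idP/idP; rewrite inE.
Qed.

(** Typed as a [pattern], so that a window can itself serve as a forbidden pattern. *)
Definition window n x : pattern d := [fmap v : box n => x (val v)]%fmap.

Lemma eq_windowP n x y :
  window n x = window n y <-> forall v, `|v| <= n%:Z -> x v = y v.
Proof.
split=> [xy v vn|xy].
  have vB : v \in box n by rewrite in_box.
  have := congr1 (fun p : pattern d => p.[? v]%fmap) xy.
  by rewrite /= !in_fnd /= !ffunE /= => -[].
congr FinMap; apply/ffunP => v; rewrite !ffunE; apply: xy.
by rewrite -in_box; exact: valP.
Qed.

Lemma window_le m n x y : (m <= n)%N ->
  window n x = window n y -> window m x = window m y.
Proof.
move=> mn /eq_windowP xy; apply/eq_windowP => v vm.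
by apply: xy; apply: le_trans vm _; rewrite lez_nat.
Qed.

Lemma finite_windows n A : finite_set [set window n x | x in full_shift A].
Proof.
pose g (f : {ffun box n -> A}) : pattern d := [fmap v => val (f v)]%fmap.
apply: (@sub_finite_set _ _ (range g)); last first.
  exact: finite_image (@finite_finset _ _).
move=> _ [x xA <-]; exists [ffun v => [` xA (val v)]%fset] => //.
by congr FinMap; apply/ffunP => v; rewrite !ffunE.
Qed.

(** A difference at norm at most [n] already forces a distance of at least [2^-n], hence the strict
    bound. *)
Lemma delta_lt_window n x y :
  delta x y < (2 ^+ n)^-1 -> window n x = window n y.
Proof.
rewrite /delta; case: asboolP => [->//|xy]; apply: contraPP => nxy.
have [v [vn xyv]] : exists v, `|v| <= n%:Z /\ x v != y v.
  apply: contrapT => /forallNP H; apply: nxy; apply/eq_windowP => v vn.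
  by apply: contrapT => /eqP ?; exact: (H v).
apply/negP; rewrite -leNgt -powR_mulrn// -powRN ler_powR ?ler1n// lerN2.
rewrite (@le_trans _ _ (`|v|%:~R))//; last first.
  by have := vn; rewrite -(ler_int R).
apply: ge_inf; last by exists v.
by exists 0 => _ [w _ <-]; rewrite ler0z.
Qed.

Lemma window_delta_le n x y :
  window n x = window n y -> delta x y <= (2 ^+ n)^-1.
Proof.
move=> /eq_windowP xyE; rewrite /delta; case: asboolP => [_|xy].
  by rewrite invr_ge0 exprn_ge0.
rewrite -powR_mulrn// -powRN ler_powR ?ler1n// lerN2.
apply: lb_le_inf.
  have [v xyv] : exists v, x v != y v.
    apply: contrapT => /forallNP H; apply: xy; apply/funext => v.
    by apply: contrapT => /eqP ?; exact: (H v).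
  by exists `|v|%:~R; exists v.
move=> _ [v /= xyv <-].
have : n%:Z <= `|v|.
  by rewrite leNgt; apply: contraNN xyv => /ltW vn; apply/eqP; exact: xyE.
by rewrite -(ler_int R).
Qed.

Lemma exists_expn_lt (e : R) : 0 < e -> exists n, (2 ^+ n)^-1 < e.
Proof.
move=> e0; have [n _ /(_ n (leqnn n))] :=
  near_infty_natSinv_expn_lt (PosNum e0).
by rewrite /= div1r; exists n.
Qed.

Lemma nbhs_windowP x (V : set (config R d)) :
  nbhs x V <-> exists n, forall y, window n x = window n y -> V y.
Proof.
split=> [/nbhs_ballP[e /= e0 xeV]|[n nV]].
  have [n ne] := exists_expn_lt e0; exists n => y /window_delta_le xy.
  by apply: xeV; rewrite ballEmdist /=; exact: le_lt_trans ne.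
apply/nbhs_ballP; exists (2 ^+ n)^-1; first by rewrite /= invr_gt0 exprn_gt0.
by move=> y; rewrite ballEmdist /= => /delta_lt_window/nV.
Qed.

Lemma closed_windowP X :
  closed X <->
  forall x, (forall n, [set window n y | y in X] (window n x)) -> X x.
Proof.
split=> [clX x Xx|XX x clx].
  apply: clX => V /nbhs_windowP[n nV]; have [y Xy yx] := Xx n.
  by exists y; split=> //; exact: nV.
apply: XX => n; have [] := clx [set y | window n x = window n y].
  by apply/nbhs_windowP; exists n.
by move=> y [Xy xy]; exists y.
Qed.

(** Along an ultrafilter each coordinate, having finitely many possible values, is eventually
    constant; these constants form the limit. *)
Lemma compact_full_shift A : compact (@full_shift R d A).
Proof.
rewrite compact_ultra => F FU FA.
have FF : ProperFilter F by exact: ultra_proper.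
have FI : Filter F by exact: filter_filter.
have FE v : exists a : int, F [set x | x v = a].
  apply: contrapT => /forallNP nF.
  have Fn a : F (~` [set x | x v = a]).
    by have [/nF|] := in_ultra_setVsetC [set x | x v = a] FU.
  have /(filterI FA)/filter_ex :=
    @filter_bigI _ _ _ _ F FI (fun (a : int) (_ : a \in A) => Fn a).
  move=> [x [xA /(_ _ (xA v))]]; exact.
have [a Fa] := choice FE.
exists a; split.
  by move=> v; have [x [xA <-]] := filter_ex (filterI FA (Fa v)); exact: xA.
move=> V /nbhs_windowP[n nV].
have := @filter_bigI _ _ _ _ F FI (fun v (_ : v \in box n) => Fa v).
apply: filterS => x xa; apply: nV; apply/eq_windowP => v vn.
by rewrite (xa v)//= in_box.
Qed.

(** * Languages and the shifts defined by allowed windows *)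

Definition language n X : set (pattern d) := [set window n x | x in X].

(** No alphabet is imposed here: compactness is obtained by intersecting with a compact set. *)
Definition window_shift n S : set (config R d) :=
  [set x | forall u, S (window n (sigma u x))].

Lemma language_subset n X Y : X `<=` Y -> language n X `<=` language n Y.
Proof. exact: image_subset. Qed.

Lemma finite_language n A X : X `<=` full_shift A -> finite_set (language n X).
Proof.
by move=> XA; apply: sub_finite_set (finite_windows n A); exact: image_subset.
Qed.

Lemma sigma0 x : sigma 0 x = x.
Proof. by apply/funext => v; rewrite /sigma add0r. Qed.

Lemma sigmaD u v x : sigma u (sigma v x) = sigma (v + u) x.
Proof. by apply/funext => w; rewrite /sigma addrA. Qed.

Definition sup_norm u : nat := absz (@Num.norm _ 'rV[int]_d u).

Lemma sup_normE u : (sup_norm u)%:Z = `|u|.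
Proof. by rewrite /sup_norm gez0_abs. Qed.

(** The ball of radius [n] translated by [u] lies in the ball of radius [n + |u|]. *)
Lemma window_sigma n u x y (m := (n + sup_norm u)%N) :
  window m x = window m y -> window n (sigma u x) = window n (sigma u y).
Proof.
move=> /eq_windowP xy; apply/eq_windowP => v vn; apply: xy.
rewrite (le_trans (ler_normD _ _))// /m PoszD addrC lerD//.
by rewrite sup_normE.
Qed.

Lemma closed_window_shift n S : closed (window_shift n S).
Proof.
apply/closed_windowP => x xS u.
have [y yS yx] := xS (n + sup_norm u)%N.
by rewrite -(window_sigma yx); exact: yS.
Qed.

Lemma window_shift_invariant n S : shift_invariant (window_shift n S).
Proof. by move=> u _ [x xS <-] v; rewrite sigmaD; exact: xS. Qed.

Lemma sub_window_shift n X :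
  shift_invariant X -> X `<=` window_shift n (language n X).
Proof.
by move=> Xi x Xx u; exists (sigma u x) => //; apply: Xi; exists x.
Qed.

Lemma language_window_shift n S : language n (window_shift n S) `<=` S.
Proof. by move=> _ [x xS <-]; rewrite -[x]sigma0; exact: xS. Qed.

Lemma shift_invariantI X Y :
  shift_invariant X -> shift_invariant Y -> shift_invariant (X `&` Y).
Proof.
move=> Xi Yi u _ [x [Xx Yx] <-].
by split; [apply: Xi|apply: Yi]; exists x.
Qed.

Lemma full_shift_invariant A : shift_invariant (@full_shift R d A).
Proof. by move=> u _ [x xA <-] v; exact: xA. Qed.

Lemma is_shift_closed X : is_shift X -> closed X.
Proof.
case=> _ _ cX _.
exact: compact_closed (@metric_hausdorff R (config R d)) cX.
Qed.

Lemma is_shift_subsystem X Y : is_shift X -> subsystem X Y -> is_shift Y.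
Proof.
move=> [[A XA] _ cX _] [YX Y0 clY Yi]; split => //.
  by exists A => x /YX/XA.
exact: subclosed_compact cX YX.
Qed.

(** * Isolation as determination by a language *)

Definition determined_by_language n X :=
  forall Z, is_shift Z -> language n Z = language n X -> Z = X.

Lemma pdist_lt x Z e : Z !=set0 -> inf [set delta x z | z in Z] < e ->
  exists2 z, Z z & delta x z < e.
Proof.
move=> [z Zz] /inf_lt[|_ [w Zw <-] we]; first by exists (delta x z), z.
by exists w.
Qed.

Lemma excess_lt_language X Z n : X !=set0 -> Z !=set0 ->
  sup [set inf [set delta x z | z in Z] | x in X] < (2 ^+ n)^-1 ->
  language n X `<=` language n Z.
Proof.
move=> X0 [z0 Zz0] XZ _ [x Xx <-].
have [||z Zz /delta_lt_window xz] := @pdist_lt x Z (2 ^+ n)^-1.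
- by exists z0.
- apply: le_lt_trans XZ; apply: ub_le_sup; last by exists x.
  exists 1 => _ [t _ <-]; apply: le_trans (delta_le1 t z0).
  by apply: ge_inf; [exists 0 => _ [? _ <-]; exact: delta_ge0|exists z0].
by exists z.
Qed.

Lemma language_excess_le X Z n : X !=set0 -> language n X `<=` language n Z ->
  sup [set inf [set delta x z | z in Z] | x in X] <= (2 ^+ n)^-1.
Proof.
move=> [x0 Xx0] XZ; apply: ge_sup.
  by exists (inf [set delta x0 z | z in Z]), x0.
move=> _ [x Xx <-]; have [|z Zz zx] := XZ (window n x); first by exists x.
apply: le_trans (window_delta_le (esym zx)).
by apply: ge_inf; [exists 0 => _ [? _ <-]; exact: delta_ge0|exists z].
Qed.

Lemma isolatedP (X : shift_space R d) :
  isolated [set: shift_space R d] X <->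
  exists n, determined_by_language n X.
Proof.
have [_ X0 _ _] := shift_is_shift X.
split=> [[_ [V /nbhs_ballP[e /= e0 XeV]]]|[n Xn]].
  rewrite setIT => VX; have [n ne] := exists_expn_lt e0.
  exists n => Z sZ ZX; have Z0 : Z !=set0 by case: sZ.
  suff : V (ShiftSpace sZ) by rewrite VX => <-.
  apply: XeV; rewrite ballEmdist /=; apply: le_lt_trans ne.
  by rewrite /mdist /= ge_max !language_excess_le//= ZX.
split; first by rewrite inE.
(* This set contains the ball of radius [2^-n] around [X], and determination reduces it to [X]. *)
exists [set Z : shift_space R d | language n Z = language n X]; last first.
  rewrite setIT; apply/seteqP; split=> [Z ZX|_ ->//].
  have ZXE : Z = X :> set _ by apply: Xn => //; exact: shift_is_shift.
  case: Z X {ZX Xn X0} ZXE => [Z pZ] [X pX] /= ZX.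
  by move: pZ; rewrite ZX => pZ; congr ShiftSpace; exact: Prop_irrelevance.
apply/nbhs_ballP; exists (2 ^+ n)^-1; first by rewrite /= invr_gt0 exprn_gt0.
move=> Z; rewrite ballEmdist /= /mdist /= gt_max => /andP[XZ ZX].
have [_ Z0 _ _] := shift_is_shift Z.
by apply/seteqP; split; exact: excess_lt_language.
Qed.

(** * Consequences of isolation *)

Lemma determined_finite_type n X :
  is_shift X -> determined_by_language n X -> finite_type X.
Proof.
move=> [[A XA] X0 cX Xi] Xn.
(* [W] is a shift with the [n]-language of [X], hence is [X]. *)
pose W := full_shift A `&` window_shift n (language n X).
have XW : X `<=` W by move=> x Xx; split; [exact: XA|exact: sub_window_shift].
have WX : W = X.
  apply: Xn; first split.
  - by exists A => x [].
  - by have [x /XW] := X0; exists x.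
  - apply: compact_closedI; first exact: compact_full_shift.
    exact: closed_window_shift.
  - apply: shift_invariantI; first exact: full_shift_invariant.
    exact: window_shift_invariant.
  apply/seteqP; split; last exact: language_subset.
  by move=> p [x [_ Wx] <-]; apply: language_window_shift; exists x.
(* The forbidden patterns are the windows over [A] that do not occur in [X]. *)
have fin : finite_set (language n (full_shift A) `\` language n X).
  apply: sub_finite_set (finite_windows n A); exact: subDsetl.
exists A, (fset_set (language n (full_shift A) `\` language n X)); split.
  move=> p; rewrite in_fset_set// inE => -[[x xA <-] _] v.
  by rewrite ffunE; exact: xA.
rewrite -[LHS]WX; apply/seteqP; split=> x [xA xX]; split=> //.
  move=> p; rewrite in_fset_set// inE => -[[y yA <-] nX] [u xu].
  apply: nX; suff <- : window n (sigma u x) = window n y by exact: xX.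
  apply/eq_windowP => v vn; have vB : v \in box n by rewrite in_box.
  by have := xu [` vB]%fset; rewrite ffunE.
move=> u; apply: contrapT => nX.
apply: (xX (window n (sigma u x))).
  rewrite in_fset_set// inE; split=> //; exists (sigma u x) => //.
  by apply: full_shift_invariant; exists x.
by exists u => v; rewrite ffunE.
Qed.

(** For subsystems [Y] of a shift [X], this is the largest subsystem of [X] whose [n]-language is
    contained in that of [Y]. *)
Definition window_hull n X Y := X `&` window_shift n (language n Y).

Lemma sub_window_hull n X Y : subsystem X Y -> Y `<=` window_hull n X Y.
Proof.
by move=> [YX _ _ Yi] y Yy; split; [exact: YX|exact: sub_window_shift].
Qed.

Lemma language_window_hull n X Y : subsystem X Y ->
  language n (window_hull n X Y) = language n Y.
Proof.
move=> YX; apply/seteqP; split; last exact/language_subset/sub_window_hull.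
by move=> p [x [_ Wx] <-]; apply: language_window_shift; exists x.
Qed.

Lemma subsystem_window_hull n X Y : is_shift X -> subsystem X Y ->
  subsystem X (window_hull n X Y).
Proof.
move=> sX YX; have [_ _ _ Xi] := sX; split.
- by move=> x [].
- by have [_ [y Yy] _ _] := YX; exists y; exact: sub_window_hull.
- apply: closedI; [exact: is_shift_closed|exact: closed_window_shift].
- exact: shift_invariantI Xi (@window_shift_invariant _ _).
Qed.

Lemma proper_window_hull n X Y : is_shift X -> determined_by_language n X ->
  proper_subsystem X Y -> proper_subsystem X (window_hull n X Y).
Proof.
move=> sX Xn [YX YnX]; split; first exact: subsystem_window_hull.
move=> WX; apply: YnX; apply: Xn; first exact: is_shift_subsystem YX.
by rewrite -(language_window_hull n YX) WX.
Qed.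

Lemma determined_finite_maximal n X :
  is_shift X -> determined_by_language n X ->
  finite_set [set Y | maximal_subsystem X Y].
Proof.
move=> sX Xn; have [[A XA] _ _ _] := sX.
(* A maximal [Y] equals its hull, which depends only on the subset [language n Y] of the finite set
   [language n X]. *)
apply: (@sub_finite_set _ _
  ((fun S => X `&` window_shift n S) @` [set S | S `<=` language n X])).
  move=> Y [pY maxY]; have [YX _] := pY; exists (language n Y).
    by apply: language_subset; case: YX.
  apply: maxY; first exact: proper_window_hull.
  exact: sub_window_hull.
have [F FE] := finite_fsetP.1 (finite_language n XA).
apply: finite_image.
apply: (@sub_finite_set _ _
  ((fun G : {fset pattern d} => [set` G]) @` [set` fpowerset F])).
  move=> S /= SX; have fS : finite_set S.
    exact: sub_finite_set SX (finite_language n XA).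
  exists (fset_set S); last exact: fset_setK.
  rewrite /= fpowersetE; apply/fsubsetP => p; rewrite in_fset_set// inE => Sp.
  by have := SX _ Sp; rewrite FE.
exact/finite_image/finite_fset.
Qed.

(* Among the proper subsystems containing Y, one with an n-language of largest
   cardinality has a maximal window hull. *)
Lemma determined_no_outcast n X :
  is_shift X -> determined_by_language n X -> ~ exists Y, outcast X Y.
Proof.
move=> sX Xn [Y [pY]]; apply; have [[A XA] _ _ _] := sX.
have fin Z : Z `<=` X -> finite_set (language n Z).
  by move=> ZX; apply: (@finite_language n A) => z /ZX/XA.
pose size_of Z := #|` fset_set (language n Z)|.
pose P := [set Z | proper_subsystem X Z /\ Y `<=` Z].
have [Z [pZ YZ] Zmax] : exists2 Z, P Z &
    forall W, P W -> (size_of W <= size_of Z)%N.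
  have bound W : P W -> (size_of W <= size_of X)%N.
    move=> [[[WX _ _ _] _] _]; apply: fsubset_leq_card.
    by rewrite -fset_set_sub; [exact: language_subset|exact: fin|exact: fin].
  pose Q m := `[< exists2 Z, P Z & size_of Z = m >].
  have Qex : exists m, Q m.
    by exists (size_of Y); apply/asboolP; exists Y => //; split.
  have Qub m : Q m -> (m <= size_of X)%N by move=> /asboolP[W /bound ? <-].
  case: (ex_maxnP Qex Qub) => m /asboolP[Z PZ <-] mmax; exists Z => // W PW.
  by apply: mmax; apply/asboolP; exists W.
have [sZ _] := pZ; have [ZX _ _ _] := sZ.
exists (window_hull n X Z); last exact: subset_trans (sub_window_hull n sZ).
split; first exact: proper_window_hull.
move=> W pW ZW; have [sW _] := pW; have [WX _ _ Wi] := sW.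
apply/seteqP; split=> // w Ww; split; first exact: WX.
(* [W] contains the hull of [Z], so its language contains that of [Z]; maximal cardinality forces
   equality. *)
suff -> : language n Z = language n W by exact: sub_window_shift.
have ZWn : language n Z `<=` language n W.
  by apply: language_subset; apply: subset_trans ZW; exact: sub_window_hull.
rewrite -(fset_setK (fin _ ZX)) -(fset_setK (fin _ WX)).
congr (fun G : {fset pattern d} => [set` G]); apply/eqP.
rewrite eqEfcard; apply/andP; split.
  by rewrite -fset_set_sub//; exact: fin.
apply: Zmax; split=> //; apply: subset_trans YZ _.
by apply: subset_trans ZW; exact: sub_window_hull.
Qed.

(** * From finite type and maximal subsystems back to isolation *)

Lemma closed_proper_language X Y :
  closed Y -> Y `<=` X -> Y <> X -> exists n, forall m, (n <= m)%N ->
  ~ language m X `<=` language m Y.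
Proof.
(* If the inclusion of languages held for arbitrarily large [m], every point of [X] would be a limit
   of points of [Y]. *)
move=> clY YX YnX; apply: contrapT => /forallNP H; apply: YnX.
apply/seteqP; split=> // x Xx; apply: (closed_windowP Y).1 => // n.
have /existsNP[m /not_implyP[nm /contrapT XY]] := H n.
have [|y Yy yx] := XY (window m x); first by exists x.
by exists y => //; exact: window_le yx.
Qed.

Lemma finite_type_determined X : finite_type X ->
  exists n0, forall n, (n0 <= n)%N -> forall Z, shift_invariant Z ->
  language n Z `<=` language n X -> Z `<=` X.
Proof.
move=> [A [F [_ XE]]].
(* The ball of radius [n0] contains the support of every forbidden pattern. *)
pose n0 := \max_(p <- F) \max_(v <- domf p) sup_norm v.
exists n0 => n n0n Z Zi ZX z Zz.
have zX u : exists2 x, X x & window n x = window n (sigma u z).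
  by apply: ZX; exists (sigma u z) => //; apply: Zi; exists z.
rewrite XE; split=> [v|p pF [u zp]].
  (* The centre of the window at [v] shows that [z v] is in the alphabet. *)
  have [x] := zX v; rewrite XE => -[xA _] /eq_windowP/(_ 0).
  by rewrite normr0 /sigma addr0 => <-.
(* An occurrence of [p] at [u] in [z] is carried to one at the origin in a point of [X]. *)
have [x] := zX u; rewrite XE => -[_ xF] /eq_windowP xz.
apply: (xF _ pF); exists 0 => v; rewrite add0r -zp xz//.
rewrite -sup_normE lez_nat (leq_trans _ n0n)//.
apply: (@leq_trans (\max_(v <- domf p) sup_norm v)).
  by apply: (@leq_bigmax_seq _ _ xpredT sup_norm) => //; exact: valP.
exact: (@leq_bigmax_seq _ _ xpredT
  (fun p : pattern d => \max_(v <- domf p) sup_norm v)).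
Qed.

Lemma determined_of_finite_type X : is_shift X -> finite_type X ->
  finite_set [set Y | maximal_subsystem X Y] -> ~ (exists Y, outcast X Y) ->
  exists n, determined_by_language n X.
Proof.
move=> sX /finite_type_determined[n0 Xn0] fin noout.
(* Finiteness of the set of maximal subsystems makes the radius uniform. *)
have [n1 Xn1] : exists n1, forall Y, maximal_subsystem X Y ->
    forall n, (n1 <= n)%N -> ~ language n X `<=` language n Y.
  have /choice[f fP] Y : exists n, maximal_subsystem X Y ->
      forall m, (n <= m)%N -> ~ language m X `<=` language m Y.
    have [[[[YX _ clY _] YnX] _]|nY] := pselect (maximal_subsystem X Y).
      by have [n nP] := closed_proper_language clY YX YnX; exists n.
    by exists 0%N.
  have [G GE] := finite_fsetP.1 fin.
  exists (\max_(Y <- G) f Y) => Y mY n fn; apply: fP => //.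
  apply: leq_trans fn; apply: (@leq_bigmax_seq _ _ xpredT f) => //.
  have : [set Y | maximal_subsystem X Y] Y := mY.
  by rewrite GE.
exists (maxn n0 n1) => Z sZ ZX; have [_ Z0 _ Zi] := sZ.
apply: contrapT => ZnX.
have pZ : proper_subsystem X Z.
  split=> //; split=> //; last exact: is_shift_closed.
  by apply: (Xn0 (maxn n0 n1)); rewrite ?leq_maxl// ZX.
(* If [Z] were proper, it would be an outcast: a maximal [Y] containing it would have the whole
   language of [X]. *)
apply: noout; exists Z; split=> // -[Y mY ZY].
apply: (Xn1 _ mY (maxn n0 n1)); first exact: leq_maxr.
by rewrite -ZX; exact: language_subset.
Qed.

End Patterns.

Theorem theorem1 (R : realType) (d : nat) (hd : (1 <= d)%N) (X : shift_space R d) :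
  isolated [set: shift_space R d] X <->
  [/\ finite_type X,
      finite_set [set Y : set (config R d) | maximal_subsystem X Y]
    & ~ exists Y : set (config R d), outcast X Y].
Proof.
have sX := shift_is_shift X; rewrite isolatedP; split=> [[n Xn]|[]].
  split; first exact: determined_finite_type Xn.
    exact: determined_finite_maximal Xn.
  exact: determined_no_outcast Xn.
exact: determined_of_finite_type.
Qed.
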